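(* Let $\mathbf{A}_d\in\mathbb{R}^{n\times n}$, $\mathbf{B}_d\in\mathbb{R}^{n\times m}$, let $\pi:\mathbb{R}^n\to\mathbb{R}^m$ be an $\ell$-layer ReLU-activated feedforward neural network, and consider the closed-loop system $\mathbf{x}(t+1)=\mathbf{f}_{cl}(\mathbf{x}(t)):=\mathbf{A}_d\mathbf{x}(t)+\mathbf{B}_d\pi(\mathbf{x}(t))$. Let $\mathcal{X}\subset\mathbb{R}^n$ be any hybrid zonotope, and let $\mathcal{H}_\pi=\langle\mathbf{G}^c_\pi,\mathbf{G}^b_\pi,\mathbf{c}_\pi,\mathbf{A}^c_\pi,\mathbf{A}^b_\pi,\mathbf{b}_\pi\rangle$ be the graph set of $\pi$ over $\mathcal{X}$ computed by the Graph Set Algorithm (defined in the context) with scalars $\alpha,\beta>0$ large enough that $\mathcal{Z}^{(k-1)}\subseteq[-\alpha,\beta]^{n_k}$ for every $k=1,\dots,\ell-1$, i.e. $\mathcal{H}_\pi=\mathcal{G}(\pi,\mathcal{X})=\{(\mathbf{x},\mathbf{u})\;|\;\mathbf{u}=\pi(\mathbf{x}),\mathbf{x}\in\mathcal{X}\}$. Let $\mathbf{D}=[\mathbf{A}_d\ \ \mathbf{B}_d]$. Then for any target set $\mathcal{T}=\langle\mathbf{G}^c_\tau,\mathbf{G}^b_\tau,\mathbf{c}_\tau,\mathbf{A}^c_\tau,\mathbf{A}^b_\tau,\mathbf{b}_\tau\rangle\subset\mathbb{R}^n$ that is a hybrid zonotope, the one-step backward reachable set $\mathcal{P}(\mathcal{T})=\{\mathbf{x}\in\mathcal{X}\;|\;\mathbf{f}_{cl}(\mathbf{x})\in\mathcal{T}\}$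 is the hybrid zonotope $$\mathcal{P}(\mathcal{T})=\langle\mathbf{G}^c_p,\mathbf{G}^b_p,\mathbf{c}_p,\mathbf{A}^c_p,\mathbf{A}^b_p,\mathbf{b}_p\rangle,$$ where $$\mathbf{G}^c_p=[\mathbf{G}^c_\pi[1:n,:]\ \ \mathbf{0}],\quad \mathbf{G}^b_p=[\mathbf{G}^b_\pi[1:n,:]\ \ \mathbf{0}],\quad \mathbf{c}_p=\mathbf{c}_\pi[1:n,:],$$ $$\mathbf{A}^c_p=\begin{bmatrix}\mathbf{A}^c_\pi&\mathbf{0}\\\mathbf{0}&\mathbf{A}^c_\tau\\\mathbf{D}\mathbf{G}^c_\pi&-\mathbf{G}^c_\tau\end{bmatrix},\quad \mathbf{A}^b_p=\begin{bmatrix}\mathbf{A}^b_\pi&\mathbf{0}\\\mathbf{0}&\mathbf{A}^b_\tau\\\mathbf{D}\mathbf{G}^b_\pi&-\mathbf{G}^b_\tau\end{bmatrix},\quad \mathbf{b}_p=\begin{bmatrix}\mathbf{b}_\pi\\\mathbf{b}_\tau\\\mathbf{c}_\tau-\mathbf{D}\mathbf{c}_\pi\end{bmatrix}.$$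
   Context: **Hybrid zonotopes.** A set $\mathcal{Z}\subset\mathbb{R}^N$ is a hybrid zonotope (HZ) if there are $\mathbf{c}\in\mathbb{R}^N$, $\mathbf{G}^c\in\mathbb{R}^{N\times n_g}$, $\mathbf{G}^b\in\mathbb{R}^{N\times n_b}$, $\mathbf{A}^c\in\mathbb{R}^{n_c\times n_g}$, $\mathbf{A}^b\in\mathbb{R}^{n_c\times n_b}$, $\mathbf{b}\in\mathbb{R}^{n_c}$ such that $$\mathcal{Z}=\{\mathbf{G}^c\xi^c+\mathbf{G}^b\xi^b+\mathbf{c}\;|\;\xi^c\in[-1,1]^{n_g},\ \xi^b\in\{-1,1\}^{n_b},\ \mathbf{A}^c\xi^c+\mathbf{A}^b\xi^b=\mathbf{b}\};$$ this is written $\mathcal{Z}=\langle\mathbf{G}^c,\mathbf{G}^b,\mathbf{c},\mathbf{A}^c,\mathbf{A}^b,\mathbf{b}\rangle$. The numbers $n_g,n_b,n_c$ may be zero. For a matrix $\mathbf{M}$, $\mathbf{M}[1:n,:]$ is the matrix of its first $n$ rows. **Network.** $\pi$ has weights $\mathbf{W}^{(k-1)}\in\mathbb{R}^{n_k\times n_{k-1}}$ and biases $\mathbf{v}^{(k-1)}\in\mathbb{R}^{n_k}$, $k=1,\dots,\ell$, with $n_0=n$, $n_\ell=m$. With $\mathbf{x}^{(0)}=\mathbf{x}$ and $\mathbf{x}^{(k)}=\phi(\mathbf{W}^{(k-1)}\mathbf{x}^{(k-1)}+\mathbf{v}^{(k-1)})$ for $k=1,\dots,\ell-1$, one sets $\pi(\mathbf{x})=\mathbf{W}^{(\ell-1)}\mathbf{x}^{(\ell-1)}+\mathbf{v}^{(\ell-1)}$.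 Here $\phi$ applies $ReLU(z)=\max\{z,0\}$ to each component. **The HZ $\mathcal{H}$.** For $\alpha,\beta>0$, $\mathcal{H}=\langle\mathbf{G}^c_h,\mathbf{G}^b_h,\mathbf{c}_h,\mathbf{A}^c_h,\mathbf{A}^b_h,\mathbf{b}_h\rangle\subset\mathbb{R}^2$ with $$\mathbf{G}^c_h=\begin{bmatrix}\frac{\alpha}{2}&\frac{\beta}{2}&0&0&0&0\\0&\frac{\beta}{2}&0&0&0&0\end{bmatrix},\ \mathbf{G}^b_h=\begin{bmatrix}-\frac{\alpha+\beta}{4}\\-\frac{\beta}{4}\end{bmatrix},\ \mathbf{c}_h=\begin{bmatrix}\frac{\beta-\alpha}{4}\\\frac{\beta}{4}\end{bmatrix},$$ $$\mathbf{A}^c_h=\begin{bmatrix}1&0&1&0&0&0\\-1&0&0&1&0&0\\0&1&0&0&1&0\\0&-1&0&0&0&1\end{bmatrix},\ \mathbf{A}^b_h=\begin{bmatrix}\frac12\\\frac12\\-\frac12\\-\frac12\end{bmatrix},\ \mathbf{b}_h=\begin{bmatrix}\frac12\\\frac12\\\frac12\\\frac12\end{bmatrix}.$$ **Operations on representations.** - Affine map: $\mathbf{W}\langle\mathbf{G}^c,\mathbf{G}^b,\mathbf{c},\mathbf{A}^c,\mathbf{A}^b,\mathbf{b}\rangle+\mathbf{v}=\langle\mathbf{W}\mathbf{G}^c,\mathbf{W}\mathbf{G}^b,\mathbf{W}\mathbf{c}+\mathbf{v},\mathbf{A}^c,\mathbf{A}^b,\mathbf{b}\rangle$. - Cartesian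 power $\mathcal{H}^{N}=\mathcal{H}\times\cdots\times\mathcal{H}$: block-diagonal $\mathbf{G}^c,\mathbf{G}^b,\mathbf{A}^c,\mathbf{A}^b$ and stacked $\mathbf{c},\mathbf{b}$. - Generalized intersection $\mathcal{Y}\cap_{\mathbf{R}}\mathcal{Z}=\{\mathbf{y}\in\mathcal{Y}\;|\;\mathbf{R}\mathbf{y}\in\mathcal{Z}\}$, with the factors of $\mathcal{Z}$ listed first: $$\mathcal{Y}\cap_{\mathbf{R}}\mathcal{Z}=\left\langle[\mathbf{0}\ \mathbf{G}^c_y],[\mathbf{0}\ \mathbf{G}^b_y],\mathbf{c}_y,\begin{bmatrix}\mathbf{A}^c_z&\mathbf{0}\\\mathbf{0}&\mathbf{A}^c_y\\-\mathbf{G}^c_z&\mathbf{R}\mathbf{G}^c_y\end{bmatrix},\begin{bmatrix}\mathbf{A}^b_z&\mathbf{0}\\\mathbf{0}&\mathbf{A}^b_y\\-\mathbf{G}^b_z&\mathbf{R}\mathbf{G}^b_y\end{bmatrix},\begin{bmatrix}\mathbf{b}_z\\\mathbf{b}_y\\\mathbf{c}_z-\mathbf{R}\mathbf{c}_y\end{bmatrix}\right\rangle.$$ **Graph Set Algorithm.** Input: $\mathcal{X}=\langle\mathbf{G}^c_x,\mathbf{G}^b_x,\mathbf{c}_x,\mathbf{A}^c_x,\mathbf{A}^b_x,\mathbf{b}_x\rangle$, $\ell$, the weights and biases, and $\alpha,\beta>0$. Set $\mathcal{X}^{(0)}=\mathcal{X}$. For $k=1,\dots,\ell-1$: (1) $\mathcal{Z}^{(k-1)}=\mathbf{W}^{(k-1)}\mathcal{X}^{(k-1)}+\mathbf{v}^{(k-1)}$;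 (2) $\mathcal{G}^{(k)}=(\mathbf{P}_k\cdot\mathcal{H}^{n_k})\cap_{[\mathbf{I}\ \mathbf{0}]}\mathcal{Z}^{(k-1)}$, where $\mathbf{P}_k=[\mathbf{e}_1\ \mathbf{e}_3\cdots\mathbf{e}_{2n_k-1}\ \mathbf{e}_2\ \mathbf{e}_4\cdots\mathbf{e}_{2n_k}]^T\in\mathbb{R}^{2n_k\times2n_k}$ ($\mathbf{e}_i$ being the $i$-th column of the identity) and $[\mathbf{I}\ \mathbf{0}]\in\mathbb{R}^{n_k\times 2n_k}$; (3) $\mathcal{X}^{(k)}=[\mathbf{0}\ \mathbf{I}]\cdot\mathcal{G}^{(k)}$ with $[\mathbf{0}\ \mathbf{I}]\in\mathbb{R}^{n_k\times2n_k}$. Then set $\mathcal{X}^{(\ell)}=\mathbf{W}^{(\ell-1)}\mathcal{X}^{(\ell-1)}+\mathbf{v}^{(\ell-1)}=:\langle\mathbf{G}^c,\mathbf{G}^b,\mathbf{c},\mathbf{A}^c,\mathbf{A}^b,\mathbf{b}\rangle$ and output $$\mathcal{H}_\pi=\left\langle\begin{bmatrix}[\mathbf{G}^c_x\ \ \mathbf{0}]\\\mathbf{G}^c\end{bmatrix},\begin{bmatrix}[\mathbf{G}^b_x\ \ \mathbf{0}]\\\mathbf{G}^b\end{bmatrix},\begin{bmatrix}\mathbf{c}_x\\\mathbf{c}\end{bmatrix},\mathbf{A}^c,\mathbf{A}^b,\mathbf{b}\right\rangle.$$ *)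

(* Defs.v *)
From HB Require Import structures.
From mathcomp Require Import all_boot all_order all_algebra.
From mathcomp Require Import boolp classical_sets reals.

Set Implicit Arguments.
Unset Strict Implicit.
Unset Printing Implicit Defensive.

Import Order.TTheory GRing.Theory Num.Theory.
Local Open Scope classical_set_scope.
Local Open Scope ring_scope.

(* A representation <Gc, Gb, c, Ac, Ab, b> of a hybrid zonotope in R^N; the
   set it represents is [hz_set] below. *)
Record hz (R : realType) (N : nat) := HZ {
  hz_ng : nat;
  hz_nb : nat;
  hz_nc : nat;
  hz_Gc : 'M[R]_(N, hz_ng);
  hz_Gb : 'M[R]_(N, hz_nb);
  hz_c : 'cV[R]_N;
  hz_Ac : 'M[R]_(hz_nc, hz_ng);
  hz_Ab : 'M[R]_(hz_nc, hz_nb);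
  hz_b : 'cV[R]_hz_nc }.

Definition hz_set (R : realType) (N : nat) (Z : hz R N) : set 'cV[R]_N :=
  [set x | exists (xc : 'cV[R]_(hz_ng Z)) (xb : 'cV[R]_(hz_nb Z)),
    [/\ forall i, -1 <= xc i 0 <= 1,
        forall i, xb i 0 = -1 \/ xb i 0 = 1,
        hz_Ac Z *m xc + hz_Ab Z *m xb = hz_b Z &
        x = hz_Gc Z *m xc + hz_Gb Z *m xb + hz_c Z]].

Definition hz_affine (R : realType) (M N : nat) (W : 'M[R]_(M, N))
    (v : 'cV[R]_M) (Z : hz R N) : hz R M :=
  HZ (W *m hz_Gc Z) (W *m hz_Gb Z) (W *m hz_c Z + v)
     (hz_Ac Z) (hz_Ab Z) (hz_b Z).

Definition hz_linear (R : realType) (M N : nat) (W : 'M[R]_(M, N))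
    (Z : hz R N) : hz R M := hz_affine W 0 Z.

Definition hz_prod (R : realType) (M N : nat) (Y : hz R M) (Z : hz R N) :
    hz R (M + N) :=
  HZ (block_mx (hz_Gc Y) 0 0 (hz_Gc Z)) (block_mx (hz_Gb Y) 0 0 (hz_Gb Z))
     (col_mx (hz_c Y) (hz_c Z))
     (block_mx (hz_Ac Y) 0 0 (hz_Ac Z)) (block_mx (hz_Ab Y) 0 0 (hz_Ab Z))
     (col_mx (hz_b Y) (hz_b Z)).

(* The dimension is [p * N], not [N * p], because [p.+1 * N] is convertible to
   [N + p * N]. *)
Fixpoint hz_pow (R : realType) (N : nat) (Z : hz R N) (p : nat) :
    hz R (p * N) :=
  match p with
  | 0%N => @HZ R 0 0 0 0 0 0 0 0 0 0
  | q.+1 => hz_prod Z (hz_pow Z q)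
  end.

(* Y \cap_Q Z, with the factors of Z listed first. *)
Definition hz_inter (R : realType) (M N : nat) (Q : 'M[R]_(N, M))
    (Y : hz R M) (Z : hz R N) : hz R M :=
  HZ (row_mx (0 : 'M_(M, hz_ng Z)) (hz_Gc Y))
     (row_mx (0 : 'M_(M, hz_nb Z)) (hz_Gb Y))
     (hz_c Y)
     (col_mx (block_mx (hz_Ac Z) 0 0 (hz_Ac Y))
             (row_mx (- hz_Gc Z) (Q *m hz_Gc Y)))
     (col_mx (block_mx (hz_Ab Z) 0 0 (hz_Ab Y))
             (row_mx (- hz_Gb Z) (Q *m hz_Gb Y)))
     (col_mx (col_mx (hz_b Z) (hz_b Y)) (hz_c Z - Q *m hz_c Y)).

Definition mx_of_rows (R : realType) (m n : nat) (s : seq (seq R)) :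
    'M[R]_(m, n) :=
  \matrix_(i, j) nth 0 (nth [::] s i) j.

Definition relu_hz (R : realType) (alpha beta : R) : hz R 2 :=
  HZ (mx_of_rows 2 6
        [:: [:: alpha / 2; beta / 2; 0; 0; 0; 0];
            [:: 0;         beta / 2; 0; 0; 0; 0]])
     (mx_of_rows 2 1 [:: [:: - ((alpha + beta) / 4)]; [:: - (beta / 4)]])
     (mx_of_rows 2 1 [:: [:: (beta - alpha) / 4]; [:: beta / 4]])
     (mx_of_rows 4 6
        [:: [:: 1;  0;  1; 0; 0; 0];
            [:: -1; 0;  0; 1; 0; 0];
            [:: 0;  1;  0; 0; 1; 0];
            [:: 0;  -1; 0; 0; 0; 1]])
     (mx_of_rows 4 1 [:: [:: 1 / 2]; [:: 1 / 2]; [:: - (1 / 2)]; [:: - (1 / 2)]])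
     (mx_of_rows 4 1 [:: [:: 1 / 2]; [:: 1 / 2]; [:: 1 / 2]; [:: 1 / 2]]).

(* [e_1 e_3 ... e_(2p-1) e_2 e_4 ... e_(2p)]^T; with indices starting at 0, its
   first p rows select the even coordinates and its last p rows the odd ones. *)
Definition deinterleave (R : realType) (p : nat) : 'M[R]_(p + p, p * 2) :=
  col_mx (\matrix_(i, j) (j == i.*2 :> nat)%:R)
         (\matrix_(i, j) (j == i.*2.+1 :> nat)%:R).

Definition box (R : realType) (N : nat) (alpha beta : R) : set 'cV[R]_N :=
  [set z | forall i, - alpha <= z i 0 <= beta].

(* The matrix [M 0] with q columns in total. The numbers of factors being only
   propositionally (not definitionally) of the form p + r, the padding is
   stated entrywise; it is the intended matrix when p <= q. *)
Definition pad_cols (R : realType) (m p q : nat) (M : 'M[R]_(m, p)) :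
    'M[R]_(m, q) :=
  \matrix_(i, j) if insub (val j) is Some j' then M i j' else 0.

(* A network with l.+1 layers (l >= 0 of them hidden) and layer widths
   d 0, ..., d l.+1 is given by weights W k and biases v k, where only the
   indices k <= l are used. *)

Definition relu (R : realType) (N : nat) (x : 'cV[R]_N) : 'cV[R]_N :=
  map_mx (fun z => Num.max z 0) x.

Fixpoint nn_state (R : realType) (d : nat -> nat)
    (W : forall k, 'M[R]_(d k.+1, d k)) (v : forall k, 'cV[R]_(d k.+1))
    (x : 'cV[R]_(d 0%N)) (k : nat) : 'cV[R]_(d k) :=
  match k with
  | 0%N => x
  | j.+1 => relu (W j *m nn_state W v x j + v j)
  end.

Definition nn_eval (R : realType) (d : nat -> nat)
    (W : forall k, 'M[R]_(d k.+1, d k)) (v : forall k, 'cV[R]_(d k.+1))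
    (l : nat) (x : 'cV[R]_(d 0%N)) : 'cV[R]_(d l.+1) :=
  W l *m nn_state W v x l + v l.

Definition graph_set (R : realType) (n m : nat) (f : 'cV[R]_n -> 'cV[R]_m)
    (X : set 'cV[R]_n) : set 'cV[R]_(n + m) :=
  [set xu | exists2 x, X x & xu = col_mx x (f x)].

Fixpoint gsa_X (R : realType) (d : nat -> nat)
    (W : forall k, 'M[R]_(d k.+1, d k)) (v : forall k, 'cV[R]_(d k.+1))
    (alpha beta : R) (X : hz R (d 0%N)) (k : nat) : hz R (d k) :=
  match k with
  | 0%N => X
  | j.+1 =>
      let Z := hz_affine (W j) (v j) (gsa_X W v alpha beta X j) in
      let G := hz_inter (row_mx 1%:M 0)
                 (hz_linear (deinterleave R (d j.+1))
                    (hz_pow (relu_hz alpha beta) (d j.+1))) Z in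
      hz_linear (row_mx 0 1%:M) G
  end.

Definition gsa_Z (R : realType) (d : nat -> nat)
    (W : forall k, 'M[R]_(d k.+1, d k)) (v : forall k, 'cV[R]_(d k.+1))
    (alpha beta : R) (X : hz R (d 0%N)) (k : nat) : hz R (d k.+1) :=
  hz_affine (W k) (v k) (gsa_X W v alpha beta X k).

(* The last layer has no activation, so the X^(l.+1) of the algorithm is
   [gsa_Z ... l] and not [gsa_X ... l.+1]. *)
Definition gsa (R : realType) (d : nat -> nat)
    (W : forall k, 'M[R]_(d k.+1, d k)) (v : forall k, 'cV[R]_(d k.+1))
    (l : nat) (alpha beta : R) (X : hz R (d 0%N)) : hz R (d 0%N + d l.+1) :=
  let Xl := gsa_Z W v alpha beta X l in
  HZ (col_mx (pad_cols (hz_ng Xl) (hz_Gc X)) (hz_Gc Xl))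
     (col_mx (pad_cols (hz_nb Xl) (hz_Gb X)) (hz_Gb Xl))
     (col_mx (hz_c X) (hz_c Xl))
     (hz_Ac Xl) (hz_Ab Xl) (hz_b Xl).

Definition closed_loop (R : realType) (n m : nat) (Ad : 'M[R]_n)
    (Bd : 'M[R]_(n, m)) (f : 'cV[R]_n -> 'cV[R]_m) (x : 'cV[R]_n) : 'cV[R]_n :=
  Ad *m x + Bd *m f x.

Definition backward_reachable (R : realType) (n : nat)
    (f : 'cV[R]_n -> 'cV[R]_n) (X T : set 'cV[R]_n) : set 'cV[R]_n :=
  [set x | X x /\ T (f x)].

(* Main.v *)
(** Every hybrid zonotope [X^(k)] built by the algorithm keeps the factors of
    [X] as its first factors. Stacking the generators of [X], padded by zeros,
    on top of those of [X^(k)] therefore represents a set of pairs [(x, y)], and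
    by induction on [k] this set is the graph over [X] of the [k]-th layer:
    [P H^p] is the graph of ReLU over [[-alpha, beta]^p], and intersecting it
    with [Z^(k-1)] applies one activation without disturbing the first component.
    The backward reachable set is then obtained from the factors of [H_pi] and
    of [T] coupled by the equation [D (x, u) = t]. *)
Require Import Defs.
From HB Require Import structures.
From mathcomp Require Import all_boot all_order all_algebra.
From mathcomp Require Import boolp classical_sets reals.
From mathcomp Require Import ring lra.

Import Order.TTheory GRing.Theory Num.Theory.
Local Open Scope classical_set_scope.
Local Open Scope ring_scope.

(** * Factors and points of a representation *)

(** Kept apart from [hz_point] because affine maps and stacking change only the point and leave the
    constraints on the factors as they are. *)
Definition hz_feasible {R : realType} {N : nat} (Z : hz R N)
    (xc : 'cV[R]_(hz_ng Z)) (xb : 'cV[R]_(hz_nb Z)) : Prop :=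
  [/\ forall i, -1 <= xc i 0 <= 1,
      forall i, xb i 0 = -1 \/ xb i 0 = 1 &
      hz_Ac Z *m xc + hz_Ab Z *m xb = hz_b Z].

Definition hz_point {R : realType} {N : nat} (Z : hz R N)
    (xc : 'cV[R]_(hz_ng Z)) (xb : 'cV[R]_(hz_nb Z)) : 'cV[R]_N :=
  hz_Gc Z *m xc + hz_Gb Z *m xb + hz_c Z.

Lemma hz_setP {R : realType} {N : nat} (Z : hz R N) (x : 'cV[R]_N) :
  hz_set Z x <-> exists xc xb, hz_feasible Z xc xb /\ x = hz_point Z xc xb.
Proof.
split=> [[xc [xb [h1 h2 h3 h4]]]|[xc [xb [[h1 h2 h3] h4]]]];
  by exists xc, xb.
Qed.

Lemma forall_col_mx {R : realType} (P : R -> Prop) (p q : nat)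
    (x : 'cV[R]_p) (y : 'cV[R]_q) :
  (forall i, P (col_mx x y i 0)) <->
  (forall i, P (x i 0)) /\ (forall i, P (y i 0)).
Proof.
split=> [h|[hx hy] i].
  split=> i; first by move: (h (lshift q i)); rewrite col_mxEu.
  by move: (h (rshift p i)); rewrite col_mxEd.
by rewrite -(splitK i); case: (split i) => j /=; rewrite ?col_mxEu ?col_mxEd.
Qed.

(** The block rows separate, and only the last row links the two factor vectors. Intersections and
    the backward reachable set both have constraints of this shape; the generators are arbitrary
    since feasibility does not see them. *)
Lemma hz_feasible_coupled {R : realType} {M N P r : nat}
    (Y : hz R M) (Z : hz R N)
    (Gc : 'M[R]_(P, hz_ng Y + hz_ng Z)) (Gb : 'M[R]_(P, hz_nb Y + hz_nb Z))
    (c : 'cV[R]_P) (Kc : 'M[R]_(r, hz_ng Y)) (Lc : 'M[R]_(r, hz_ng Z))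
    (Kb : 'M[R]_(r, hz_nb Y)) (Lb : 'M[R]_(r, hz_nb Z)) (k : 'cV[R]_r)
    (yc : 'cV[R]_(hz_ng Y)) (yb : 'cV[R]_(hz_nb Y))
    (zc : 'cV[R]_(hz_ng Z)) (zb : 'cV[R]_(hz_nb Z)) :
  hz_feasible
    (HZ Gc Gb c
       (col_mx (block_mx (hz_Ac Y) 0 0 (hz_Ac Z)) (row_mx Kc Lc))
       (col_mx (block_mx (hz_Ab Y) 0 0 (hz_Ab Z)) (row_mx Kb Lb))
       (col_mx (col_mx (hz_b Y) (hz_b Z)) k))
    (col_mx yc zc) (col_mx yb zb) <->
  [/\ hz_feasible Y yc yb, hz_feasible Z zc zb &
      (Kc *m yc + Kb *m yb) + (Lc *m zc + Lb *m zb) = k].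
Proof.
rewrite /hz_feasible /= !mul_col_mx !mul_row_col.
rewrite !mul0mx !addr0 !add0r !add_col_mx addrACA.
split=> [[/(forall_col_mx (fun t => is_true (-1 <= t <= 1))) [? ?]]|].
  move=> /(forall_col_mx (fun t => t = -1 \/ t = 1)) [? ?].
  by move=> /eq_col_mx [] /eq_col_mx [].
move=> [[yc1 yb1 ->] [zc1 zb1 ->] ->]; split=> //.
- exact/(forall_col_mx (fun t => is_true (-1 <= t <= 1))).
- exact/(forall_col_mx (fun t => t = -1 \/ t = 1)).
Qed.

(** * Affine images, products and powers *)

Lemma hz_set_affine {R : realType} {M N : nat} (A : 'M[R]_(M, N))
    (b : 'cV[R]_M) (Z : hz R N) :
  hz_set (hz_affine A b Z) = [set A *m x + b | x in hz_set Z].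
Proof.
have pointE xc xb :
    hz_point (hz_affine A b Z) xc xb = A *m hz_point Z xc xb + b.
  by rewrite /hz_point /= !mulmxDr !mulmxA addrA.
apply/seteqP; split=> y /=.
  move=> /hz_setP [xc [xb [xf ->]]]; exists (hz_point Z xc xb).
    by apply/hz_setP; exists xc, xb.
  by rewrite pointE.
move=> [x /hz_setP [xc [xb [xf ->]]] <-].
by apply/hz_setP; exists xc, xb; rewrite pointE.
Qed.

Lemma hz_set_prod {R : realType} {M N : nat} (Y : hz R M) (Z : hz R N)
    (y : 'cV[R]_M) (z : 'cV[R]_N) :
  hz_set (hz_prod Y Z) (col_mx y z) <-> hz_set Y y /\ hz_set Z z.
Proof.
have feasE yc yb zc zb :
    hz_feasible (hz_prod Y Z) (col_mx yc zc) (col_mx yb zb) <->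
    hz_feasible Y yc yb /\ hz_feasible Z zc zb.
  rewrite /hz_feasible /= !mul_block_col !mul0mx !addr0 !add0r !add_col_mx.
  split=> [[/(forall_col_mx (fun t => is_true (-1 <= t <= 1))) [? ?]]|].
    by move=> /(forall_col_mx (fun t => t = -1 \/ t = 1)) [? ?] /eq_col_mx [].
  move=> [[yc1 yb1 ->] [zc1 zb1 ->]]; split=> //.
  - exact/(forall_col_mx (fun t => is_true (-1 <= t <= 1))).
  - exact/(forall_col_mx (fun t => t = -1 \/ t = 1)).
have pointE yc yb zc zb :
    hz_point (hz_prod Y Z) (col_mx yc zc) (col_mx yb zb) =
    col_mx (hz_point Y yc yb) (hz_point Z zc zb).
  by rewrite /hz_point /= !mul_block_col !mul0mx !addr0 !add0r !add_col_mx.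
split.
  move=> /hz_setP [xc [xb]]; rewrite -(vsubmxK xc) -(vsubmxK xb).
  rewrite pointE => -[/feasE [hy hz] /eq_col_mx [-> ->]].
  by split; apply/hz_setP; do 2 eexists; split=> //; eassumption.
move=> [/hz_setP [yc [yb [hy ->]]] /hz_setP [zc [zb [hz ->]]]].
apply/hz_setP; exists (col_mx yc zc), (col_mx yb zb).
by rewrite pointE; split=> //; apply/feasE.
Qed.

(** Copy [i] occupies the coordinates from [i * N] on. Comparing indices as natural numbers avoids
    casts between ordinal types. *)
Lemma hz_set_pow {R : realType} {N : nat} (Z : hz R N) (p : nat)
    (z : 'cV[R]_(p * N)) :
  hz_set (hz_pow Z p) z <->
  exists2 f : 'I_p -> 'cV[R]_N, forall i, hz_set Z (f i) &
    forall (i : 'I_p) (j : 'I_N) (k : 'I_(p * N)),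
      k = (i * N + j)%N :> nat -> z k 0 = f i j 0.
Proof.
elim: p z => [|p IHp] z.
  split=> [_|_]; first by exists (fun=> 0) => -[].
  by exists 0, 0; split=> [[]|[]||] //; apply/matrixP => -[].
(* The dimension [p.+1 * N] is split as [N + p * N] by conversion, hence the explicit sizes. *)
rewrite -[z](@vsubmxK _ N (p * N) 1).
move: (@usubmx _ N (p * N) 1 z) (@dsubmx _ N (p * N) 1 z) => {z} u w.
split.
  move=> /hz_set_prod [hu /IHp [f hf fE]].
  (* Index 0 owns the top block; the other indices drop by one into the smaller power. *)
  exists (fun i => if unlift ord0 i is Some i' then f i' else u).
    by move=> i; case: unliftP => [i'|] _.
  move=> i j k; case: unliftP => [i'|] -> /= kE.
    have hk : (i' * N + j < p * N)%N.
      by have := ltn_ord k; rewrite kE /bump leq0n add1n mulSn -addnA ltn_add2l.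
    have -> : k = rshift N (Ordinal hk).
      by apply: val_inj; rewrite /= kE /bump leq0n add1n mulSn addnA.
    by rewrite col_mxEd; apply: fE.
  have -> : k = lshift (p * N) j by apply: val_inj; rewrite /= kE mul0n.
  by rewrite col_mxEu.
move=> [f hf fE]; apply/hz_set_prod; split.
  have -> : u = f ord0; last exact: hf.
  apply/matrixP => j j0; rewrite ord1 -(fE ord0 j (lshift (p * N) j)) //.
  by rewrite col_mxEu.
apply/IHp; exists (fun i => f (lift ord0 i)) => // i j k kE.
rewrite -(fE (lift ord0 i) j (rshift N k)) ?col_mxEd //=.
by rewrite kE /bump leq0n add1n mulSn addnA.
Qed.

(** * The graph of ReLU as a hybrid zonotope *)

(** Reading the factors through a function on [nat] lets the sum unfold by computation when the
    matrix is a literal. *)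
Lemma mx_of_rows_mulE {R : realType} {m n : nat} (s : seq (seq R))
    (x : 'cV[R]_n) (t : nat -> R) (i : 'I_m) (k : 'I_1) :
    (forall j, x j 0 = t j) ->
  (mx_of_rows m n s *m x) i k = \sum_(0 <= j < n) nth 0 (nth [::] s i) j * t j.
Proof.
move=> xE; rewrite mxE big_mkord; apply: eq_bigr => j _.
by rewrite mxE ord1 xE.
Qed.

(** Turns the matrix data into scalar equations fit for [lra]. The factors [t 2] to [t 5] act as
    slacks: their bounds become inequalities on [t 0] and [t 1] that depend on the sign [s]. *)
Lemma hz_relu_factorsP {R : realType} (alpha beta : R)
    (xc : 'cV[R]_6) (xb : 'cV[R]_1) (z : 'cV[R]_2) (t : nat -> R) (s : R) :
    (forall j, xc j 0 = t j) -> (forall j, xb j 0 = s) ->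
  (hz_feasible (relu_hz alpha beta) xc xb /\
   z = hz_point (relu_hz alpha beta) xc xb) <->
  [/\ forall j, (j < 6)%N -> -1 <= t j <= 1, s = -1 \/ s = 1,
      [/\ t 0%N + t 2%N + s / 2 = 1 / 2, - t 0%N + t 3%N + s / 2 = 1 / 2,
          t 1%N + t 4%N - s / 2 = 1 / 2 & - t 1%N + t 5%N - s / 2 = 1 / 2],
      z 0 0 = alpha / 2 * t 0%N + beta / 2 * t 1%N - (alpha + beta) / 4 * s
              + (beta - alpha) / 4 &
      z 1 0 = beta / 2 * t 1%N - beta / 4 * s + beta / 4].
Proof.
move=> xcE xbE.
have AE i : (hz_Ac (relu_hz alpha beta) *m xc +
             hz_Ab (relu_hz alpha beta) *m xb) i 0 =
    nth 0 [:: t 0%N + t 2%N + s / 2; - t 0%N + t 3%N + s / 2;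
              t 1%N + t 4%N - s / 2; - t 1%N + t 5%N - s / 2] i.
  rewrite mxE (mx_of_rows_mulE _ _ _ _ _ xcE).
  rewrite (mx_of_rows_mulE _ _ (fun=> s) _ _ xbE).
  rewrite unlock; case: i => [[|[|[|[|//]]]]] ? /=; lra.
have bE i : hz_b (relu_hz alpha beta) i 0 = 1 / 2.
  by rewrite mxE; case: i => [[|[|[|[|//]]]]].
have pE i : hz_point (relu_hz alpha beta) xc xb i 0 =
    nth 0 [:: alpha / 2 * t 0%N + beta / 2 * t 1%N - (alpha + beta) / 4 * s
              + (beta - alpha) / 4;
              beta / 2 * t 1%N - beta / 4 * s + beta / 4] i.
  rewrite mxE mxE (mx_of_rows_mulE _ _ _ _ _ xcE).
  rewrite (mx_of_rows_mulE _ _ (fun=> s) _ _ xbE) mxE.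
  rewrite unlock; case: i => [[|[|//]]] ? /=; lra.
split.
  move=> [[hc hb hA] ->]; split; rewrite ?pE //.
  - by move=> j j6; rewrite -(xcE (Ordinal j6)); apply: hc.
  - by rewrite -(xbE 0); apply: hb.
  (* Typing the row index as ['I_4] lets the numerals below denote rows. *)
  - have E (j : 'I_4) := AE j.
    by split; [have := AE 0|have := AE 1|have := AE 2%:R|have := AE 3%:R];
       rewrite hA bE => /= <-.
move=> [ht hs [e0 e1 e2 e3] z0 z1]; split; first split.
- by move=> j; rewrite xcE; apply: ht.
- by move=> j; rewrite xbE.
- apply/matrixP => i j; rewrite ord1 AE bE.
  by case: i => [[|[|[|[|//]]]]].
- apply/matrixP => i j; rewrite ord1 pE.
  case: i => [[|[|//]]] hi /=.
  + by rewrite -z0; congr (z _ 0); apply: val_inj.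
  + by rewrite -z1; congr (z _ 0); apply: val_inj.
Qed.

(* The binary factor selects the branch: [1] forces the second continuous factor
   to vanish (inactive branch), [-1] the first one (active branch). *)
Lemma hz_set_relu {R : realType} (alpha beta : R) (z : 'cV[R]_2) :
    0 < alpha -> 0 < beta ->
  hz_set (relu_hz alpha beta) z <->
  - alpha <= z 0 0 <= beta /\ z 1 0 = Num.max (z 0 0) 0.
Proof.
move=> a0 b0; split.
  move=> /hz_setP [xc [xb h]].
  pose t j := xc (inord j) 0.
  have xcE j : xc j 0 = t j by rewrite /t inord_val.
  have xbE j : xb j 0 = xb 0 0 by rewrite ord1.
  move: h => /(hz_relu_factorsP _ _ _ _ _ _ _ xcE xbE).
  move: t (xb 0 0) {xcE xbE} => t s.
  move=> [ht hs [e0 e1 e2 e3] z0 z1].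
  have /andP [? ?] := ht 0%N isT; have /andP [? ?] := ht 1%N isT.
  have /andP [? ?] := ht 2%N isT; have /andP [? ?] := ht 3%N isT.
  have /andP [? ?] := ht 4%N isT; have /andP [? ?] := ht 5%N isT.
  case: hs => hs; subst s.
  (* For [s = -1] the slacks are [1 - t 0] and [1 + t 0]; both are at most 1, so [t 0] vanishes.
     Then both coordinates equal [beta * (1 + t 1) / 2], and the products below supply its bounds to
     linear arithmetic. *)
  - have t0 : t 0%N = 0 by lra.
    have b1 : 0 <= beta * (1 + t 1%N) by rewrite pmulr_rge0 //; lra.
    have b2 : 0 <= beta * (1 - t 1%N) by rewrite pmulr_rge0 //; lra.
    rewrite t0 in z0.
    have h : 0 <= z 0 0 <= beta by apply/andP; split; lra.
    have /andP [h0 h1] := h.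
    by rewrite max_l //; split; first (apply/andP; split); lra.
  (* For [s = 1] the slacks [1 - t 1] and [1 + t 1] force [t 1 = 0], leaving the input
     [alpha * (t 0 - 1) / 2] and the output 0. *)
  - have t1 : t 1%N = 0 by lra.
    have a1 : 0 <= alpha * (1 + t 0%N) by rewrite pmulr_rge0 //; lra.
    have a2 : 0 <= alpha * (1 - t 0%N) by rewrite pmulr_rge0 //; lra.
    rewrite t1 in z0 z1.
    have h : - alpha <= z 0 0 <= 0 by apply/andP; split; lra.
    have /andP [h0 h1] := h.
    by rewrite max_r //; split; first (apply/andP; split); lra.
move=> [/andP [hl hu] hz].
have [z_ge0|z_lt0] := leP 0 (z 0 0).
- rewrite max_l // in hz.
  (* Solves [beta * (1 + u) / 2 = z 0 0]; the slacks are then read off the constraints with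
     [s = -1]. *)
  pose u := 2 * z 0 0 / beta - 1.
  have bu : beta * u = 2 * z 0 0 - beta by rewrite /u; field; rewrite gt_eqF.
  have u1 : -1 <= u by rewrite -(ler_pM2l b0); lra.
  have u2 : u <= 1 by rewrite -(ler_pM2l b0); lra.
  pose t := nth 0 [:: 0; u; 1; 1; - u; u].
  apply/hz_setP; exists (\col_j t j), (const_mx (-1)).
  apply/(hz_relu_factorsP _ _ _ _ _ t (-1)); try by move=> j; rewrite mxE.
  rewrite /t; split=> /=; [|by left|by split; lra|lra|lra].
  by case=> [|[|[|[|[|[|//]]]]]] _ /=; lra.
rewrite max_r ?ltW // in hz.
(* Solves [alpha * (u - 1) / 2 = z 0 0], now with [s = 1]. *)
pose u := 2 * z 0 0 / alpha + 1.
have au : alpha * u = 2 * z 0 0 + alpha by rewrite /u; field; rewrite gt_eqF.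
have u1 : -1 <= u by rewrite -(ler_pM2l a0); lra.
have u2 : u <= 1 by rewrite -(ler_pM2l a0); lra.
pose t := nth 0 [:: u; 0; - u; u; 1; 1].
apply/hz_setP; exists (\col_j t j), (const_mx 1).
apply/(hz_relu_factorsP _ _ _ _ _ t 1); try by move=> j; rewrite mxE.
rewrite /t; split=> /=; [|by right|by split; lra|lra|lra].
by case=> [|[|[|[|[|[|//]]]]]] _ /=; lra.
Qed.

(** The power lists one input-output pair per neuron; the permutation gathers the inputs before the
    outputs, so the scalar graphs form the graph of the componentwise map. *)
Lemma hz_set_relu_pow {R : realType} (alpha beta : R) (p : nat)
    (y : 'cV[R]_(p + p)) :
    0 < alpha -> 0 < beta ->
  hz_set (hz_linear (deinterleave R p) (hz_pow (relu_hz alpha beta) p)) y <->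
  exists2 x, box alpha beta x & y = col_mx x (relu x).
Proof.
move=> a0 b0.
have even_lt (i : 'I_p) : (i.*2 < p * 2)%N by rewrite muln2 ltn_double.
have odd_lt (i : 'I_p) : (i.*2.+1 < p * 2)%N by rewrite muln2 ltn_Sdouble.
have deintE (z : 'cV[R]_(p * 2)) : deinterleave R p *m z =
    col_mx (\col_i z (Ordinal (even_lt i)) 0) (\col_i z (Ordinal (odd_lt i)) 0).
  rewrite /deinterleave mul_col_mx; congr col_mx; apply/matrixP => i j;
    rewrite !mxE ord1.
  - rewrite (bigD1 (Ordinal (even_lt i))) //= !mxE eqxx mul1r big1 ?addr0 //.
    by move=> k; rewrite -val_eqE /= => /negbTE kE; rewrite !mxE kE mul0r.
  - rewrite (bigD1 (Ordinal (odd_lt i))) //= !mxE eqxx mul1r big1 ?addr0 //.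
    by move=> k; rewrite -val_eqE /= => /negbTE kE; rewrite !mxE kE mul0r.
rewrite /hz_linear hz_set_affine; split.
  move=> [z /hz_set_pow [f hf fE] <-]; rewrite addr0 deintE.
  have z0 i : z (Ordinal (even_lt i)) 0 = f i 0 0.
    by apply: fE; rewrite /= addn0 muln2.
  have z1 i : z (Ordinal (odd_lt i)) 0 = f i 1 0.
    by apply: fE; rewrite /= addn1 muln2.
  exists (\col_i z (Ordinal (even_lt i)) 0).
    by move=> i; rewrite mxE z0; case/hz_set_relu: (hf i).
  congr col_mx; apply/matrixP => i j; rewrite !mxE z0 z1.
  by case/hz_set_relu: (hf i).
move=> [x hx ->].
have half_lt (k : 'I_(p * 2)) : (k./2 < p)%N by rewrite ltn_half_double -muln2.
(* Interleaves [x] with [relu x]: coordinate [k] belongs to neuron [k./2], odd ones being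
   outputs. *)
exists (\col_k if odd k then Num.max (x (Ordinal (half_lt k)) 0) 0
               else x (Ordinal (half_lt k)) 0); last first.
  rewrite addr0 deintE; congr col_mx; apply/matrixP => i j;
    rewrite !mxE /= odd_double /= ord1.
  - by congr (x _ 0); apply: val_inj; rewrite /= doubleK.
  - congr (Num.max (x _ 0) 0); apply: val_inj.
    by rewrite /= uphalf_double.
apply/hz_set_pow.
exists (fun i => \col_j if odd j then Num.max (x i 0) 0 else x i 0).
  by move=> i; apply/hz_set_relu => //; rewrite !mxE /=; split; first exact: hx.
move=> i j k kE; rewrite !mxE.
have -> : Ordinal (half_lt k) = i.
  apply: val_inj; rewrite /= kE muln2; case: j {kE} => [[|[|//]]] _ /=.
  - by rewrite addn0 doubleK.
  - by rewrite addn1 /= uphalf_double.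
by rewrite kE oddD muln2 odd_double.
Qed.

(** * Stacking the input set on top of a derived set *)

(* With this definition, [gsa] is [hz_stack X (gsa_Z ... l)]. *)
Definition hz_stack {R : realType} {n m : nat} (X : hz R n) (Y : hz R m) :
    hz R (n + m) :=
  HZ (col_mx (pad_cols (hz_ng Y) (hz_Gc X)) (hz_Gc Y))
     (col_mx (pad_cols (hz_nb Y) (hz_Gb X)) (hz_Gb Y))
     (col_mx (hz_c X) (hz_c Y))
     (hz_Ac Y) (hz_Ab Y) (hz_b Y).

Lemma hz_point_stack {R : realType} {n m : nat} (X : hz R n) (Y : hz R m)
    (yc : 'cV[R]_(hz_ng Y)) (yb : 'cV[R]_(hz_nb Y)) :
  hz_point (hz_stack X Y) yc yb =
  col_mx (pad_cols _ (hz_Gc X) *m yc + pad_cols _ (hz_Gb X) *m yb + hz_c X)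
         (hz_point Y yc yb).
Proof. by rewrite /hz_point /= !mul_col_mx !add_col_mx. Qed.

Lemma pad_cols_id {R : realType} {m p : nat} (M : 'M[R]_(m, p)) :
  pad_cols p M = M.
Proof. by apply/matrixP => i j; rewrite mxE valK. Qed.

(** Factors appended at the end get zero generators. If [q < p], [pad_cols q M] would truncate [M],
    and lost columns would reappear among the new ones. *)
Lemma pad_cols_addn {R : realType} {m p : nat} (q r : nat) (M : 'M[R]_(m, p)) :
  (p <= q)%N -> pad_cols (q + r) M = row_mx (pad_cols q M) 0.
Proof.
move=> pq; apply/matrixP => i j; rewrite -(splitK j).
case: (split j) => k /=; rewrite ?row_mxEl ?row_mxEr !mxE //=.
by rewrite insubN // -leqNgt (leq_trans pq) // leq_addr.
Qed.

(** Base case of the induction on layers: the same factors generate both components, which gives the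
    diagonal. *)
Lemma hz_set_stack_id {R : realType} {n : nat} (X : hz R n) (x y : 'cV[R]_n) :
  hz_set (hz_stack X X) (col_mx x y) <-> hz_set X x /\ y = x.
Proof.
have pointE xc xb : hz_point (hz_stack X X) xc xb =
    col_mx (hz_point X xc xb) (hz_point X xc xb).
  by rewrite hz_point_stack !pad_cols_id.
split.
  move=> /hz_setP [xc [xb []]]; rewrite pointE => xf /eq_col_mx [-> ->].
  by split=> //; apply/hz_setP; exists xc, xb.
move=> [/hz_setP [xc [xb [xf ->]]] ->].
by apply/hz_setP; exists xc, xb; rewrite pointE.
Qed.

Lemma hz_set_stack_dsub {R : realType} {n m : nat} (X : hz R n) (Y : hz R m)
    (x : 'cV[R]_n) (y : 'cV[R]_m) :
  hz_set (hz_stack X Y) (col_mx x y) -> hz_set Y y.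
Proof.
move=> /hz_setP [yc [yb []]]; rewrite hz_point_stack => yf /eq_col_mx [_ ->].
by apply/hz_setP; exists yc, yb.
Qed.

Lemma hz_set_stack_affine {R : realType} {n m r : nat} (X : hz R n)
    (Y : hz R m) (A : 'M[R]_(r, m)) (b : 'cV[R]_r)
    (x : 'cV[R]_n) (y : 'cV[R]_r) :
  hz_set (hz_stack X (hz_affine A b Y)) (col_mx x y) <->
  exists2 z, hz_set (hz_stack X Y) (col_mx x z) & y = A *m z + b.
Proof.
have pointE yc yb :
    hz_point (hz_affine A b Y) yc yb = A *m hz_point Y yc yb + b.
  by rewrite /hz_point /= !mulmxDr !mulmxA addrA.
split.
  move=> /hz_setP [yc [yb []]]; rewrite hz_point_stack pointE => yf.
  move=> /eq_col_mx [-> ->]; exists (hz_point Y yc yb) => //.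
  by apply/hz_setP; exists yc, yb; rewrite hz_point_stack.
move=> [z /hz_setP [yc [yb []]]]; rewrite hz_point_stack => yf.
move=> /eq_col_mx [-> ->] ->; apply/hz_setP; exists yc, yb.
by rewrite hz_point_stack pointE.
Qed.

(** Brings an equality of two points into the form of a coupling row, with factor terms on the left
    and centers on the right. *)
Lemma eq_addr_subr {V : zmodType} (a b c e : V) :
  b + e = a + c <-> b - a = c - e.
Proof.
split=> h; first by rewrite -[b](addrK e) h addrAC [a + c]addrC addrK.
by rewrite -[b](subrK a) h addrAC subrK addrC.
Qed.

(** The factors of [Z] come first, so those of [X] keep their place and the top component depends on
    the factors of [Z] only. The last constraint row forces the point of [Z] to be [Q *m y]. *)
Lemma hz_set_stack_inter {R : realType} {n m r : nat} (X : hz R n)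
    (Y : hz R m) (Z : hz R r) (Q : 'M[R]_(r, m))
    (x : 'cV[R]_n) (y : 'cV[R]_m) :
    (hz_ng X <= hz_ng Z)%N -> (hz_nb X <= hz_nb Z)%N ->
  hz_set (hz_stack X (hz_inter Q Y Z)) (col_mx x y) <->
  hz_set Y y /\ hz_set (hz_stack X Z) (col_mx x (Q *m y)).
Proof.
move=> leg leb.
have pointE zc zb yc yb :
    hz_point (hz_stack X (hz_inter Q Y Z)) (col_mx zc yc) (col_mx zb yb) =
    col_mx (usubmx (hz_point (hz_stack X Z) zc zb)) (hz_point Y yc yb).
  rewrite !hz_point_stack col_mxKu /= !pad_cols_addn // !mul_row_col !mul0mx.
  by rewrite !addr0 /hz_point /= !mul_row_col !mul0mx !add0r.
have feasE zc zb yc yb :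
    hz_feasible (hz_stack X (hz_inter Q Y Z)) (col_mx zc yc) (col_mx zb yb) <->
    [/\ hz_feasible Z zc zb, hz_feasible Y yc yb &
        Q *m hz_point Y yc yb = hz_point Z zc zb].
  have eqE : (Q *m hz_point Y yc yb = hz_point Z zc zb) <->
      (- hz_Gc Z *m zc + - hz_Gb Z *m zb) +
      (Q *m hz_Gc Y *m yc + Q *m hz_Gb Y *m yb) = hz_c Z - Q *m hz_c Y.
    rewrite /hz_point !mulmxDr !mulmxA !mulNmx -opprD.
    by rewrite [- _ + _]addrC; exact: eq_addr_subr.
  split=> [/hz_feasible_coupled [? ? /eqE]|[? ? /eqE ?]] //.
  exact/hz_feasible_coupled.
split.
  move=> /hz_setP [xc [xb]]; rewrite -(vsubmxK xc) -(vsubmxK xb) pointE.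
  move=> [/feasE [zf yf QE] /eq_col_mx [-> ->]].
  split; apply/hz_setP; first by exists (dsubmx xc), (dsubmx xb).
  exists (usubmx xc), (usubmx xb); split=> //.
  by rewrite QE hz_point_stack col_mxKu.
move=> [/hz_setP [yc [yb [yf ->]]] /hz_setP [zc [zb []]]].
rewrite hz_point_stack => zf /eq_col_mx [-> QE].
apply/hz_setP; exists (col_mx zc yc), (col_mx zb yb).
by rewrite pointE hz_point_stack col_mxKu; split=> //; apply/feasE.
Qed.

(** * The algorithm computes the graph of the network *)

Lemma gsa_X_factors {R : realType} {d : nat -> nat}
    (W : forall k, 'M[R]_(d k.+1, d k)) (v : forall k, 'cV[R]_(d k.+1))
    (alpha beta : R) (X : hz R (d 0%N)) (k : nat) :
  (hz_ng X <= hz_ng (gsa_X W v alpha beta X k))%N /\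
  (hz_nb X <= hz_nb (gsa_X W v alpha beta X k))%N.
Proof.
elim: k => [//|k [hg hb]] /=.
by split; [apply: leq_trans hg _|apply: leq_trans hb _]; apply: leq_addr.
Qed.

(** The invariant concerns pairs because [X^(k)] alone forgets which input produced a state. Each
    layer is an affine map, an intersection with the ReLU graph, and a projection. *)
Lemma hz_set_stack_gsa_X {R : realType} {d : nat -> nat}
    (W : forall k, 'M[R]_(d k.+1, d k)) (v : forall k, 'cV[R]_(d k.+1))
    (alpha beta : R) (X : hz R (d 0%N)) (k : nat)
    (x : 'cV[R]_(d 0%N)) (y : 'cV[R]_(d k)) :
    0 < alpha -> 0 < beta ->
    (forall j, (j < k)%N ->
       hz_set (gsa_Z W v alpha beta X j) `<=` box alpha beta) ->
  hz_set (hz_stack X (gsa_X W v alpha beta X k)) (col_mx x y) <->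
  hz_set X x /\ y = nn_state W v x k.
Proof.
move=> a0 b0; elim: k y => [|k IHk] y hbox /=; first exact: hz_set_stack_id.
have {}IHk := IHk _ (fun j jk => hbox j (ltnW jk)).
have [hg hb] := gsa_X_factors W v alpha beta X k.
have ZE z : hz_set (hz_stack X (gsa_Z W v alpha beta X k)) (col_mx x z) <->
    hz_set X x /\ z = W k *m nn_state W v x k + v k.
  rewrite /gsa_Z hz_set_stack_affine.
  split=> [[s /IHk [hx ->] ->] //|[hx ->]].
  by exists (nn_state W v x k) => //; apply/IHk.
rewrite /hz_linear hz_set_stack_affine; split.
  move=> [w /hz_set_stack_inter-/(_ hg hb)].
  move=> [/hz_set_relu_pow-/(_ a0 b0) [s _ ->]].
  rewrite mul_row_col mul1mx mul0mx addr0 => /ZE [hx ->] ->.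
  by rewrite mul_row_col mul1mx mul0mx add0r addr0.
move=> [hx ->]; set s := W k *m _ + _.
have hs : hz_set (hz_stack X (gsa_Z W v alpha beta X k)) (col_mx x s).
  exact/ZE.
exists (col_mx s (relu s)); last first.
  by rewrite mul_row_col mul1mx mul0mx add0r addr0.
apply/hz_set_stack_inter => //; split.
  apply/hz_set_relu_pow => //; exists s => //.
  (* The box bound on [Z^(k)] enters here: the pre-activation [s] lies in the domain of the ReLU
     graph, so the intersection loses no input. *)
  by apply: (hbox k) => //; apply: hz_set_stack_dsub hs.
by rewrite mul_row_col mul1mx mul0mx addr0.
Qed.

(** The output layer is one more affine map applied to the graph of the last hidden state. *)
Lemma hz_set_gsa {R : realType} (l : nat) {d : nat -> nat}
    (W : forall k, 'M[R]_(d k.+1, d k)) (v : forall k, 'cV[R]_(d k.+1))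
    (alpha beta : R) (X : hz R (d 0%N)) :
    0 < alpha -> 0 < beta ->
    (forall k, (k < l)%N ->
       hz_set (gsa_Z W v alpha beta X k) `<=` box alpha beta) ->
  hz_set (gsa W v l alpha beta X) = graph_set (nn_eval W v l) (hz_set X).
Proof.
move=> a0 b0 hbox.
rewrite -[gsa _ _ _ _ _ _]/(hz_stack X (gsa_Z W v alpha beta X l)).
apply/seteqP; split=> [xu|_ [x hx ->]].
  rewrite -(vsubmxK xu) => /hz_set_stack_affine [z].
  move=> /hz_set_stack_gsa_X-/(_ a0 b0 hbox) [hx ->] ->.
  by exists (usubmx xu).
apply/hz_set_stack_affine; exists (nn_state W v x l) => //.
exact/hz_set_stack_gsa_X.
Qed.

(** * The one-step backward reachable set *)

Theorem theorem2 (R : realType) (l : nat) (d : nat -> nat)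
    (W : forall k, 'M[R]_(d k.+1, d k)) (v : forall k, 'cV[R]_(d k.+1))
    (Ad : 'M[R]_(d 0%N)) (Bd : 'M[R]_(d 0%N, d l.+1))
    (X : hz R (d 0%N)) (alpha beta : R)
    (halpha : 0 < alpha) (hbeta : 0 < beta)
    (hbox : forall k, (k < l)%N ->
       hz_set (gsa_Z W v alpha beta X k) `<=` box alpha beta) :
  let Hpi := gsa W v l alpha beta X in
  let D := row_mx Ad Bd in
  hz_set Hpi = graph_set (nn_eval W v l) (hz_set X) /\
  forall T : hz R (d 0%N),
    backward_reachable (closed_loop Ad Bd (nn_eval W v l)) (hz_set X) (hz_set T)
    = hz_set
        (HZ (row_mx (usubmx (hz_Gc Hpi)) (0 : 'M_(d 0%N, hz_ng T)))
            (row_mx (usubmx (hz_Gb Hpi)) (0 : 'M_(d 0%N, hz_nb T)))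
            (usubmx (hz_c Hpi))
            (col_mx (block_mx (hz_Ac Hpi) 0 0 (hz_Ac T))
                    (row_mx (D *m hz_Gc Hpi) (- hz_Gc T)))
            (col_mx (block_mx (hz_Ab Hpi) 0 0 (hz_Ab T))
                    (row_mx (D *m hz_Gb Hpi) (- hz_Gb T)))
            (col_mx (col_mx (hz_b Hpi) (hz_b T)) (hz_c T - D *m hz_c Hpi))).
Proof.
move=> Hpi D; have HpiE := hz_set_gsa l W v alpha beta X halpha hbeta hbox.
split=> [//|T]; rewrite -/Hpi in HpiE.
set P := HZ _ _ _ _ _ _.
have pointE xc xb tc tb : hz_point P (col_mx xc tc) (col_mx xb tb) =
    usubmx (hz_point Hpi xc xb).
  rewrite /hz_point /= !mul_row_col !mul0mx !addr0 !mul_usub_mx.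
  by rewrite -!linearD.
(* The last constraint row couples the two sets of factors: [D] sends the point of [Hpi] to the
   point of [T]. *)
have feasE xc xb tc tb :
    hz_feasible P (col_mx xc tc) (col_mx xb tb) <->
    [/\ hz_feasible Hpi xc xb, hz_feasible T tc tb &
        D *m hz_point Hpi xc xb = hz_point T tc tb].
  have eqE : (D *m hz_point Hpi xc xb = hz_point T tc tb) <->
      (D *m hz_Gc Hpi *m xc + D *m hz_Gb Hpi *m xb) +
      (- hz_Gc T *m tc + - hz_Gb T *m tb) = hz_c T - D *m hz_c Hpi.
    rewrite /hz_point !mulmxDr !mulmxA !mulNmx -opprD.
    exact: eq_addr_subr.
  split=> [/hz_feasible_coupled [? ? /eqE]|[? ? /eqE ?]] //.
  exact/hz_feasible_coupled.
have DE x : D *m col_mx x (nn_eval W v l x) =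
    closed_loop Ad Bd (nn_eval W v l) x by rewrite mul_row_col.
apply/seteqP; split=> x.
  move=> [hx /hz_setP [tc [tb [tf tE]]]].
  (* Factors for [x] are taken from its pair in the graph, so that [D] maps their point to the
     successor of [x]. *)
  have : hz_set Hpi (col_mx x (nn_eval W v l x)) by rewrite HpiE; exists x.
  move=> /hz_setP [xc [xb [xf xE]]].
  apply/hz_setP; exists (col_mx xc tc), (col_mx xb tb).
  rewrite pointE -xE col_mxKu; split=> //.
  by apply/feasE; rewrite -xE DE.
move=> /hz_setP [xc [xb]]; rewrite -(vsubmxK xc) -(vsubmxK xb) pointE.
move=> [/feasE [xf tf fE] ->].
have : hz_set Hpi (hz_point Hpi (usubmx xc) (usubmx xb)).
  by apply/hz_setP; exists (usubmx xc), (usubmx xb).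
(* A point of [Hpi] is a pair of some [x'] and its control, so the coupling equation says that the
   successor of [x'] is the point of [T]. *)
rewrite HpiE => -[x' hx' xE]; rewrite xE DE in fE *.
rewrite col_mxKu; split=> //.
by rewrite fE; apply/hz_setP; exists (dsubmx xc), (dsubmx xb).
Qed.
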